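(* Let $W\ge1$ be the number of ranks and $N\ge 1$ the number of dataset identities (the full-epoch quota). Consider a training run of the protocol under non-join termination with trainer-side quota control. Let $S_{\max}$ be the largest realized global emit count of one aligned trainer step, and let $S_{\mathrm{emit}}$ be the global cumulative trainer-side emitted-sample count at termination. Then: (1) (no leak) within every logical iteration, at every protocol round, every sampler view is in exactly one of the four protocol states: emitted, collate buffer, worker queue, or sampler-pending; (2) (sample-quota closure) the trainer-side control logic, which chains logical iterations, ends with $$N\le S_{\mathrm{emit}}\le N+S_{\max}.$$ Hence $\eta_{\mathrm{quota}}:=\max(0,\,1-S_{\mathrm{emit}}/N)=0$.
   Context: Sampler. Dataset identities are $\mathcal I=\{0,\dots,N-1\}$. In each logical iteration, a globally shuffled list of all $N$ identities is extended, by cyclically re-using identities of the list, to a list of $M=W\lceil N/W\rceil$ entries called sampler views (a repeated identity gives distinct views), which is stride-sharded over the ranks $r\in\{0,\dots,W-1\}$, so that rank $r$ receives a family $\mathcal D_r$ of $\lceil N/W\rceil$ views; view positions are disjoint across ranks. State. In a logical iteration, at protocol round $k$, rank $r$ has state $(R_r,Q_r,B_r,E_r)$: $R_r$ = sampler-pending views, not yet yielded; $Q_r$ = views in the worker queue; $B_r$ = views in the collate buffer, not yet emitted; $E_r$ = views already emitted to the trainer. Initially $R_r=\mathcal D_r$ and the other components are empty. The only state changes are: Fetch (move a subset of $R_r$ to $Q_r$), Drain (move $Q_r$ into $B_r$), Emit (move a group $g\subseteq B_r$ to $E_r$), and the no-op. Non-join termination. In each round all ranks exchange a status by a collective all-gather.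 A logical iteration ends as soon as any rank signals that it is finished. The trainer keeps a counter of emitted samples, cumulative over logical iterations; after each aligned trainer step (one training step executed jointly by the ranks) it adds the realized global number of samples emitted in that step. If a logical iteration ends while the counter is below $N$, a new logical iteration with a re-shuffled sampler is started. The run terminates at the first aligned step after which the counter is at least $N$; the value of the counter at that moment is $S_{\mathrm{emit}}$. *)

(* Defs.v *)
From Stdlib Require Import Relations.
From mathcomp Require Import all_boot all_order all_algebra.
Set Implicit Arguments.
Unset Strict Implicit.
Unset Printing Implicit Defensive.

Inductive protocol_state := Emitted | Collate | Queued | Pending.

(* Ended: the current logical iteration was ended by a finish signal and the
   next one has not been started yet.  Terminated: the whole run is over. *)
Inductive run_phase := Running | Ended | Terminated.

Section Protocol.
Variables W N : nat.

(* the ceiling of N / W *)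
Definition shard_size := (N + W.-1) %/ W.

Definition num_views := W * shard_size.

(* A view is an entry of the extended list: a position together with the
   identity at that position, so that a repeated identity gives distinct
   views. *)
Definition view := ('I_num_views * 'I_N)%type.

Definition shuffled (l : seq 'I_N) := perm_eq l (enum 'I_N).

(* num_views copies of l are always enough to take num_views entries (N > 0). *)
Definition extended_list (l : seq 'I_N) : seq 'I_N :=
  take num_views (flatten (nseq num_views l)).

Definition sampler_views (l : seq 'I_N) : {set view} :=
  [set v : view | onth (extended_list l) v.1 == Some v.2].

(* stride sharding: rank r receives the positions r, r + W, r + 2W, ... *)
Definition shard (l : seq 'I_N) (r : 'I_W) : {set view} :=
  [set v in sampler_views l | v.1 %% W == r].

Record rank_state := RankState {
  pending : {set view};
  queue : {set view};
  buffer : {set view};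
  emitted : {set view} }.

Definition component (x : rank_state) (p : protocol_state) : {set view} :=
  match p with
  | Emitted => emitted x
  | Collate => buffer x
  | Queued => queue x
  | Pending => pending x
  end.

Definition init_state (l : seq 'I_N) (r : 'I_W) : rank_state :=
  RankState (shard l r) set0 set0 set0.

Inductive state_change : rank_state -> rank_state -> Prop :=
| Fetch (R Q B E X : {set view}) of X \subset R :
    state_change (RankState R Q B E) (RankState (R :\: X) (Q :|: X) B E)
| Drain (R Q B E : {set view}) :
    state_change (RankState R Q B E) (RankState R set0 (B :|: Q) E)
| Emit (R Q B E g : {set view}) of g \subset B :
    state_change (RankState R Q B E) (RankState R Q (B :\: g) (E :|: g))
| Noop (x : rank_state) : state_change x x.

(* Between two consecutive status exchanges a rank performs any finite number
   of state changes. *)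
Definition rank_round : rank_state -> rank_state -> Prop :=
  clos_refl_trans rank_state state_change.

Definition emit_count (st st' : 'I_W -> rank_state) : nat :=
  \sum_(r < W) #|emitted (st' r) :\: emitted (st r)|.

(* step_emits is a log of the global emit counts of the aligned trainer steps
   of the run so far; shuffle and states belong to the current logical
   iteration, counter and step_emits to the whole run. *)
Record config := Config {
  shuffle : seq 'I_N;
  states : 'I_W -> rank_state;
  counter : nat;
  step_emits : seq nat;
  phase : run_phase }.

(* non-join termination, decided from the all-gathered finish signals *)
Definition phase_after (finished : 'I_W -> bool) : run_phase :=
  if [exists r, finished r] then Ended else Running.

(* A protocol round may or may not carry an aligned trainer step.  When a rank
   signals that it is finished is left unconstrained. *)
Inductive transition : config -> config -> Prop :=
| RoundWithStep l (st st' : 'I_W -> rank_state) n es (finished : 'I_W -> bool)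
    of (forall r, rank_round (st r) (st' r)) :
    let n' := n + emit_count st st' in
    transition
      (Config l st n es Running)
      (Config l st' n' (rcons es (emit_count st st'))
         (if N <= n' then Terminated else phase_after finished))
| RoundWithoutStep l (st st' : 'I_W -> rank_state) n es
    (finished : 'I_W -> bool)
    of (forall r, rank_round (st r) (st' r)) :
    transition
      (Config l st n es Running)
      (Config l st' n es (phase_after finished))
| NewIteration l (st : 'I_W -> rank_state) n es l' of n < N & shuffled l' :
    transition
      (Config l st n es Ended)
      (Config l' (init_state l') n es Running).

Definition initial (c : config) : Prop :=
  exists2 l, shuffled l & c = Config l (init_state l) 0 [::] Running.

(* c 0, ..., c T are the successive configurations of a run; the run need not
   have terminated at c T. *)
Definition training_run (T : nat) (c : nat -> config) : Prop :=
  initial (c 0) /\ forall t, t < T -> transition (c t) (c t.+1).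

Definition no_leak (c : config) : Prop :=
  forall v, v \in sampler_views (shuffle c) ->
    exists! rp : 'I_W * protocol_state, v \in component (states c rp.1) rp.2.

Definition S_max (c : config) : nat := \max_(e <- step_emits c) e.

End Protocol.

Definition eta_quota (N S_emit : nat) : rat :=
  Num.max 0%R (1 - S_emit%:R / N%:R)%R.

(* Main.v *)
(* Two invariants of the transition relation. At each rank, the number of
   components containing a view is 1 if the view belongs to the shard of the
   rank and 0 otherwise; stride sharding puts every view into exactly one shard.
   As long as the run has not terminated the counter is below N, so the last
   aligned step overshoots N by less than its own emit count. *)
Require Import Defs.
From mathcomp Require Import all_boot all_order all_algebra.
Import Order.TTheory GRing.Theory Num.Theory.

(** One numeric equation encodes both disjointness and covering, so its preservation is a finite
    Boolean check at each view. It also keeps views outside [D] out of the rank. *)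
Definition holds_exactly {W N : nat} (D : {set view W N}) (x : rank_state W N) :=
  forall v, (v \in emitted x) + (v \in buffer x) + (v \in queue x)
            + (v \in pending x) = (v \in D) :> nat.

Definition quota_inv {W N : nat} (c : config W N) : Prop :=
  if phase c is Terminated then N <= counter c <= N + S_max c else counter c < N.

Definition shards_inv {W N : nat} (c : config W N) : Prop :=
  forall r, holds_exactly (shard (shuffle c) r) (states c r).

Lemma state_change_holds_exactly (W N : nat) (D : {set view W N})
    (x y : rank_state W N) :
  state_change x y -> holds_exactly D x -> holds_exactly D y.
Proof.
case=> {x y} [R Q B E X sXR|R Q B E|R Q B E g sgB|x] // Dx v;
  have {Dx} := Dx v; rewrite /= !inE.
(* A view in [X] but not in [R] would enter the queue without leaving the pending set; [sXR]
   excludes this, as [sgB] does for an emit. *)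
- by have := subsetP sXR v; do 6!case: (v \in _) => //=; move=> /(_ isT).
- by do 5!case: (v \in _).
- by have := subsetP sgB v; do 6!case: (v \in _) => //=; move=> /(_ isT).
Qed.

Lemma rank_round_holds_exactly (W N : nat) (D : {set view W N})
    (x y : rank_state W N) :
  rank_round x y -> holds_exactly D x -> holds_exactly D y.
Proof.
elim=> {x y} [x y|x|x y z _ IHxy _ IHyz] //.
  exact: state_change_holds_exactly.
by move=> /IHxy.
Qed.

Lemma init_state_holds_exactly (W N : nat) (l : seq 'I_N) (r : 'I_W) :
  holds_exactly (shard l r) (init_state l r).
Proof. by move=> v; rewrite /= !inE. Qed.

(** Rounds keep the shuffle, hence the shards; a new iteration changes both, but its reset
    re-establishes the invariant whatever the old states were. *)
Lemma transition_shards_inv (W N : nat) (c c' : config W N) :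
  transition c c' -> shards_inv c -> shards_inv c'.
Proof.
case=> {c c'} [l st st' n es f rd n' Ic r|l st st' n es f rd Ic r|l st n es l' _ _ _ r].
- exact: rank_round_holds_exactly (rd r) (Ic r).
- exact: rank_round_holds_exactly (rd r) (Ic r).
- exact: init_state_holds_exactly.
Qed.

Lemma transition_quota_inv (W N : nat) (c c' : config W N) :
  transition c c' -> quota_inv c -> quota_inv c'.
Proof.
rewrite /quota_inv; case=> {c c'} [l st st' n es f _ n'|l st st' n es f _|] //=.
- move=> ltnN; case: (leqP N n') => [_|ltn'N].
    (* The emit count just added to the counter is the last log entry, hence at most [S_max]. *)
    by rewrite /= leq_add ?(ltnW ltnN) // /S_max /= big_rcons leq_maxr.
  by rewrite /phase_after; case: ifP.
- by rewrite /phase_after; case: ifP.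
Qed.

Lemma training_run_ind (W N : nat) (P : config W N -> Prop) (T : nat)
    (c : nat -> config W N) :
  (forall d, initial d -> P d) ->
  (forall d d', transition d d' -> P d -> P d') ->
  training_run T c -> forall t, t <= T -> P (c t).
Proof.
move=> P0 PS [c0 cS]; elim=> [_|t IHt ltT]; first exact: P0.
exact: PS (cS t ltT) (IHt (ltnW ltT)).
Qed.

Lemma shards_inv_no_leak (W N : nat) (c : config W N) :
  0 < W -> shards_inv c -> no_leak c.
Proof.
move=> W_gt0 Ic v lv; pose r0 := Ordinal (ltn_pmod v.1 W_gt0).
have shardE r : (v \in shard (shuffle c) r) = (r == r0).
  by rewrite inE lv /= eq_sym.
(* At any rank other than [r0] the count for [v] is 0, which rules out every component there. *)
have only_r0 r p : v \in component (states c r) p -> r = r0.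
  move=> vp; apply/eqP; rewrite -shardE; move: (Ic r v) vp.
  by case: (_ \in shard _ _) => //; case: p => /=; do 4!case: (v \in _).
have {Ic} := Ic r0 v; rewrite shardE eqxx => count1.
have [p vp] : exists p, v \in component (states c r0) p.
  case vE: (v \in emitted (states c r0)); first by exists Emitted.
  case vB: (v \in buffer (states c r0)); first by exists Collate.
  case vQ: (v \in queue (states c r0)); first by exists Queued.
  (* The count at [r0] is 1, so [v] must be pending once the other three fail. *)
  by exists Pending => /=; move: count1; rewrite vE vB vQ; case: (v \in _).
exists (r0, p); split=> // -[r q] /= vq; have rE := only_r0 r q vq.
(* Two distinct states at [r0] would make the count at least 2. *)
rewrite {}rE in vq *; congr (_, _); move: count1 vp vq.
by case: p; case: q => //=; do 4!case: (v \in _).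
Qed.

Lemma eta_quota_eq0 (N S_emit : nat) :
  0 < N -> N <= S_emit -> eta_quota N S_emit = 0%R.
Proof.
move=> N_gt0 leNS; apply/max_idPl.
by rewrite subr_le0 ler_pdivlMr ?ltr0n // mul1r ler_nat.
Qed.

Theorem theorem2 (W N : nat) (hW : 1 <= W) (hN : 1 <= N)
    (T : nat) (c : nat -> config W N) (hrun : training_run T c) :
  (forall t, t <= T -> no_leak (c t)) /\
  (phase (c T) = Terminated ->
     let S_emit := counter (c T) in
     N <= S_emit <= N + S_max (c T) /\ eta_quota N S_emit = 0%R).
Proof.
split=> [t letT|cT S_emit].
  apply: shards_inv_no_leak => //; move: t letT.
  apply: training_run_ind hrun => [d [l _ ->] r|d d'].
    exact: init_state_holds_exactly.
  exact: transition_shards_inv.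
have : quota_inv (c T).
  (* The counter starts at 0, so the base case is [hN]. *)
  apply: (training_run_ind _ _ _ T c _ _ hrun) (leqnn T) => [d [l _ ->] //|d d'].
  exact: transition_quota_inv.
rewrite /quota_inv cT => bounds; split=> //.
by apply: eta_quota_eq0 => //; case/andP: bounds.
Qed.
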